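(* Let $\mathbf{S}=\{A_1,\dots,A_m\}\subset\mathbb{S}^n$ and $b\in\mathbb{R}^m$. If $b\in SH(\mathbf{S})$, then there exists $X\in\mathbf{\Delta}_n$ with $p(X)=(A_1\bullet X,\dots,A_m\bullet X)^T=b$ such that $X$ can be written as a convex combination of at most $\min\{m+1,n\}$ rank-one matrices of the form $vv^T$, where $v\in\mathbb{R}^n$, $\Vert v\Vert=1$.
   Context: $\mathbb{S}^n$ is the space of real symmetric $n\times n$ matrices with inner product $X\bullet Y=\mathrm{Tr}(XY)$. The spectraplex is $\mathbf{\Delta}_n=\{X\in\mathbb{S}^n: \mathrm{Tr}(X)=1,\ X\succeq 0\}$ (with $X\succeq0$ meaning positive semidefinite). For $\mathbf{S}=\{A_1,\dots,A_m\}\subset\mathbb{S}^n$ and $X\in\mathbf{\Delta}_n$, $p(X)=(A_1\bullet X,\dots,A_m\bullet X)^T\in\mathbb{R}^m$; the spectrahull is $SH(\mathbf{S})=\{p(X): X\in\mathbf{\Delta}_n\}\subset\mathbb{R}^m$. $\Vert\cdot\Vert$ is the Euclidean norm. *)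

(* Defs.v *)
From mathcomp Require Import all_boot all_order all_algebra.
From mathcomp Require Import classical_sets reals.

Set Implicit Arguments.
Unset Strict Implicit.
Unset Printing Implicit Defensive.

Import Order.TTheory GRing.Theory Num.Theory.
Local Open Scope classical_set_scope.
Local Open Scope ring_scope.

(* X \bullet Y = Tr(XY) on S^n *)
Definition tr_inner {R : realType} {n : nat} (X Y : 'M[R]_n) : R :=
  \tr (X *m Y).

Definition psdmx {R : realType} {n : nat} (X : 'M[R]_n) : Prop :=
  X \is symmetricmx /\ forall x : 'cV[R]_n, 0 <= (x^T *m X *m x) ord0 ord0.

Definition spectraplex {R : realType} {n : nat} : set 'M[R]_n :=
  [set X | \tr X = 1 /\ psdmx X].

Definition spectramap {R : realType} {m n : nat} (A : 'I_m -> 'M[R]_n)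
    (X : 'M[R]_n) : 'cV[R]_m :=
  \col_(i < m) tr_inner (A i) X.

Definition spectrahull {R : realType} {m n : nat} (A : 'I_m -> 'M[R]_n) :
    set 'cV[R]_m :=
  [set spectramap A X | X in spectraplex].

(* The norm that MathComp-Analysis puts on matrices is the sup norm. *)
Definition enorm {R : realType} {n : nat} (v : 'cV[R]_n) : R :=
  Num.sqrt (\sum_(i < n) v i ord0 ^+ 2).

(* X is a convex combination of k (not necessarily distinct) matrices v v^T
   with v a unit vector; such matrices automatically have rank one. *)
Definition convex_comb_unit_rank1 {R : realType} {n : nat} (k : nat)
    (X : 'M[R]_n) : Prop :=
  exists (c : 'I_k -> R) (v : 'I_k -> 'cV[R]_n),
    [/\ forall j, 0 <= c j,
        \sum_(j < k) c j = 1,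
        forall j, enorm (v j) = 1
      & X = \sum_(j < k) c j *: (v j *m (v j)^T)].

(* Main.v *)
(** A positive semidefinite [X] is a sum of [n] matrices [w w^T] by Cholesky
    elimination, and normalizing the [w]'s exhibits it as a convex combination
    of [n] matrices [v v^T] with [v] a unit vector.  Carathéodory's theorem for
    cones, applied to the vectors [(tr (v v^T), p (v v^T))] of [R^(m+1)], thins
    this combination out to at most [m+1] terms without changing the trace or
    the value of [p]. *)
Require Import Defs.
From mathcomp Require Import all_boot all_order all_algebra.
From mathcomp Require Import classical_sets reals.
From mathcomp Require Import ring lra.

Set Implicit Arguments.
Unset Strict Implicit.
Unset Printing Implicit Defensive.

Import Order.TTheory GRing.Theory Num.Theory.
Local Open Scope ring_scope.

Lemma caratheodory_cone_step (R : realFieldType) (N k : nat)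
    (P : 'M[R]_(k.+1, N)) (c : 'rV[R]_k.+1) :
  (N < k.+1)%N -> (forall j, 0 <= c 0 j) ->
  exists j0 (c' : 'rV[R]_k),
    (forall j, 0 <= c' 0 j) /\ c' *m rowsub (lift j0) P = c *m P.
Proof.
move=> ltNk c_ge0.
have [a aP0 [j aj_gt0]] : exists2 a : 'rV[R]_k.+1, a *m P = 0 &
    exists j, 0 < a 0 j.
  have kerN0 : kermx P != 0.
    rewrite kermx_eq0 /row_free neq_ltn (leq_ltn_trans _ ltNk) //.
    exact: rank_leq_col.
  have /rowV0Pn [a /sub_kermxP aP0 aN0] := kerN0.
  have [j aj] : exists j, a 0 j != 0.
    by case/rV0Pn: aN0 => j aj; exists j.
  (* Up to replacing [a] by [- a], some entry is positive, so the ratios minimized below form a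
     nonempty family. *)
  have [aj_gt0|aj_lt0|aj0] := ltgtP 0 (a 0 j).
  - by exists a => //; exists j.
  - exists (- a); first by rewrite mulNmx aP0 oppr0.
    by exists j; rewrite mxE oppr_gt0.
  - by rewrite -aj0 eqxx in aj.
(* Ratio test: the least ratio [t] is the longest step for which [c - t *: a] stays nonnegative, and
   entry [j0] then vanishes. *)
have [j0 aj0_gt0 j0_min] := @arg_minP _ _ _ j (fun i => 0 < a 0 i)
  (fun i => c 0 i / a 0 i) aj_gt0.
pose t := c 0 j0 / a 0 j0.
pose d := c - t *: a.
have dP : d *m P = c *m P by rewrite mulmxBl -scalemxAl aP0 scaler0 subr0.
have d_ge0 i : 0 <= d 0 i.
  rewrite !mxE subr_ge0; have [ai_gt0|ai_le0] := ltP 0 (a 0 i).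
    by rewrite -ler_pdivlMr //; apply: j0_min.
  apply: le_trans (c_ge0 i); apply: mulr_ge0_le0 => //.
  by rewrite divr_ge0 // ltW.
have dj0 : d 0 j0 = 0.
  by rewrite !mxE /t divfK ?subrr // gt_eqF.
exists j0, (\row_j d 0 (lift j0 j)); split=> [j'|]; first by rewrite mxE.
rewrite -dP; apply/rowP=> i; rewrite !mxE.
rewrite [RHS](bigD1_ord j0) //= dj0 mul0r add0r.
by apply: eq_bigr => j' _; rewrite !mxE.
Qed.

(** Rows are dropped one at a time until at most [N] remain; [f] composes the successive [lift]s and
    so records which rows survive. *)
Lemma caratheodory_cone (R : realFieldType) (N k : nat)
    (P : 'M[R]_(k, N)) (c : 'rV[R]_k) :
  (forall j, 0 <= c 0 j) ->
  exists l (f : 'I_l -> 'I_k) (c' : 'rV[R]_l),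
    [/\ (l <= minn N k)%N, forall j, 0 <= c' 0 j
      & c' *m rowsub f P = c *m P].
Proof.
elim: k => [|k IHk] in P c *.
  move=> c_ge0; exists 0, id, c; split=> //.
  by congr (_ *m _); apply/matrixP=> i j; rewrite mxE.
move=> c_ge0; have [leNk|ltNk] := leqP k.+1 N.
  exists k.+1, id, c; split=> //.
  by congr (_ *m _); apply/matrixP=> i j; rewrite mxE.
have [j0 [c1 [c1_ge0 c1P]]] := caratheodory_cone_step P ltNk c_ge0.
have [l [f [c' [le_l c'_ge0 c'P]]]] := IHk (rowsub (lift j0) P) _ c1_ge0.
exists l, (lift j0 \o f), c'; split=> //.
  exact: leq_trans le_l (geq_minl _ _).
by rewrite -c1P -c'P; congr (_ *m _); apply/matrixP=> i j; rewrite !mxE.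
Qed.

Lemma symmetricmxP (R : realType) (n : nat) (X : 'M[R]_n) :
  X \is symmetricmx <-> X^T = X.
Proof.
split=> [/is_hermitianmxP|XT].
  by rewrite expr0 scale1r map_mx_id // => <-.
by apply/is_hermitianmxP; rewrite expr0 scale1r map_mx_id.
Qed.

(** The quadratic form of [X] is nonnegative at every [s *: x + t *: y]; two choices of [(s, t)]
    suffice, according to whether [a] vanishes. *)
Lemma psdmx_cauchy_schwarz (R : realType) (n : nat) (X : 'M[R]_n)
    (x y : 'cV[R]_n) :
  psdmx X ->
  (y^T *m X *m x) 0 0 ^+ 2 <= (x^T *m X *m x) 0 0 * (y^T *m X *m y) 0 0.
Proof.
move=> [/symmetricmxP XT X_ge0].
set a := (x^T *m X *m x) 0 0; set b := (y^T *m X *m x) 0 0.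
set c := (y^T *m X *m y) 0 0.
have xy : (x^T *m X *m y) 0 0 = b.
  have -> : x^T *m X *m y = (y^T *m X *m x)^T.
    by rewrite !trmx_mul trmxK XT mulmxA.
  by rewrite mxE.
have q_ge0 s t : 0 <= s ^+ 2 * a + 2 * (s * t) * b + t ^+ 2 * c.
  have := X_ge0 (s *: x + t *: y).
  rewrite [(_ + _)^T]linearD /= ![(_ *: _)^T]linearZ /=.
  rewrite !mulmxDl !mulmxDr -!scalemxAl -!scalemxAr.
  rewrite ![fun_of_matrix (_ + _) _ _]mxE ![fun_of_matrix (_ *: _) _ _]mxE.
  rewrite -/a -/b -/c xy => h.
  by apply: le_trans h _; rewrite le_eqVlt; apply/orP; left; apply/eqP; ring.
have a_ge0 : 0 <= a by apply: X_ge0.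
have c_ge0 : 0 <= c by apply: X_ge0.
have [a0|aN0] := eqVneq a 0.
  (* For [a = 0] this choice gives [0 <= - (c + 2) * b ^+ 4], which forces [b = 0]. *)
  rewrite a0 mul0r; have := q_ge0 (- (c + 1) * b) (b ^+ 2).
  rewrite a0; have b2_ge0 := sqr_ge0 b.
  nra.
have a_gt0 : 0 < a by rewrite lt_neqAle eq_sym aN0.
(* The value of the form here is [a * (a * c - b ^+ 2)]. *)
have h := q_ge0 (- b) a.
rewrite -subr_ge0 -(pmulr_rge0 _ a_gt0).
by apply: le_trans h _; rewrite le_eqVlt; apply/orP; left; apply/eqP; ring.
Qed.

(** Elimination runs from the last index down: only the leading [k] by [k] block is still nonzero,
    and each pivot costs one dyad. *)
Lemma psdmx_dyad_decomp (R : realType) (n k : nat) (X : 'M[R]_n) :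
  psdmx X -> (k <= n)%N ->
  (forall i j : 'I_n, (k <= i)%N -> X i j = 0) ->
  exists w : 'I_k -> 'cV[R]_n, X = \sum_(j < k) w j *m (w j)^T.
Proof.
elim: k => [|k IHk] in X *.
  move=> _ _ X0; exists (fun _ => 0); rewrite big_ord0.
  by apply/matrixP=> i j; rewrite X0 // mxE.
move=> psdX ltkn X0; have [/symmetricmxP XT X_ge0] := psdX.
pose e := Ordinal ltkn; pose u := col e X.
pose de : 'cV[R]_n := delta_mx e 0.
have uE : X *m de = u by rewrite -colE.
have eXe : (de^T *m X *m de) 0 0 = X e e.
  by rewrite trmx_delta -mulmxA uE -rowE !mxE.
have CS (y : 'cV[R]_n) : (y^T *m u) 0 0 ^+ 2 <= X e e * (y^T *m X *m y) 0 0.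
  by rewrite -uE mulmxA -eXe; apply: psdmx_cauchy_schwarz.
have d_ge0 : 0 <= X e e by rewrite -eXe; apply: X_ge0.
have Xsym i j : X i j = X j i by rewrite -[in LHS]XT mxE.
have Xe0 i : X e e = 0 -> X i e = 0.
  move=> d0; have := CS (delta_mx i 0).
  rewrite d0 mul0r trmx_delta -rowE !mxE => h.
  by apply/eqP; rewrite -sqrf_eq0 eq_le h sqr_ge0.
(* If [X e e = 0] the whole column [u] vanishes, so that the junk value
   [0^-1 = 0] does no harm here. *)
pose Y := X - (X e e)^-1 *: (u *m u^T).
have YE i j : Y i j = X i j - (X e e)^-1 * (X i e * X j e).
  by rewrite !mxE big_ord1 !mxE.
(* Nonnegativity of the Schur complement [Y] is the inequality [CS] divided by the pivot; for a zero
   pivot the subtracted term is zero. *)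
have psdY : psdmx Y.
  split.
    by apply/symmetricmxP/matrixP=> i j; rewrite mxE !YE Xsym [X i e * _]mulrC.
  move=> y; rewrite mulmxBr mulmxBl -scalemxAr -scalemxAl.
  have -> : y^T *m (u *m u^T) *m y = (y^T *m u) *m (y^T *m u)^T.
    by rewrite trmx_mul trmxK !mulmxA.
  rewrite mxE [fun_of_matrix (- _) _ _]mxE [fun_of_matrix (_ *: _) _ _]mxE.
  rewrite [fun_of_matrix (_ *m _^T) _ _]mxE big_ord1.
  rewrite [fun_of_matrix _^T _ _]mxE -expr2 subr_ge0.
  have [d0|dN0] := eqVneq (X e e) 0.
    by rewrite d0 invr0 mul0r; apply: X_ge0.
  by rewrite ler_pdivrMl ?lt_neqAle 1?eq_sym ?dN0 //; apply: CS.
have Y0 (i j : 'I_n) : (k <= i)%N -> Y i j = 0.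
  rewrite leq_eqVlt YE => /orP[/eqP ki|ltki]; last first.
    by rewrite !(X0 i) // mul0r mulr0 subr0.
  have -> : i = e by apply: val_inj.
  have [d0|dN0] := eqVneq (X e e) 0.
    by rewrite d0 !(Xsym e) (Xe0 j) // mulr0 mulr0 subr0.
  by rewrite mulKf // Xsym subrr.
have [w YW] := IHk _ psdY (ltnW ltkn) Y0.
(* The last index carries the dyad just split off, the others those of [Y]. *)
exists (fun j => oapp w ((Num.sqrt (X e e))^-1 *: u) (unlift ord_max j)).
rewrite big_ord_recr /= unlift_none /=.
under eq_bigr => j _.
  have -> : widen_ord (leqnSn k) j = lift ord_max j.
    by apply: val_inj; rewrite /= /bump leqNgt ltn_ord.
  rewrite liftK /=; over.
rewrite -YW /Y [(_ *: _)^T]linearZ /= -scalemxAl -scalemxAr scalerA.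
rewrite -invfM -expr2.
by rewrite sqr_sqrtr // subrK.
Qed.

Lemma mxtrace_dyad (R : realType) (n : nat) (v : 'cV[R]_n) :
  \tr (v *m v^T) = enorm v ^+ 2.
Proof.
rewrite sqr_sqrtr; last by apply: sumr_ge0 => i _; apply: sqr_ge0.
by apply: eq_bigr => i _; rewrite !mxE big_ord1 mxE expr2.
Qed.

Lemma enormZ (R : realType) (n : nat) (a : R) (v : 'cV[R]_n) :
  enorm (a *: v) = `|a| * enorm v.
Proof.
rewrite /enorm; under eq_bigr do rewrite mxE exprMn.
by rewrite -mulr_sumr sqrtrM ?sqr_ge0 // sqrtr_sqr.
Qed.

Lemma enorm_eq0 (R : realType) (n : nat) (v : 'cV[R]_n) :
  enorm v = 0 -> v = 0.
Proof.
move=> /eqP; rewrite sqrtr_eq0 => le0.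
have sq_ge0 (i : 'I_n) : true -> 0 <= v i 0 ^+ 2 by move=> _; apply: sqr_ge0.
have /eqP : \sum_(i < n) v i 0 ^+ 2 = 0.
  by apply/eqP; rewrite eq_le le0 sumr_ge0.
rewrite psumr_eq0 // => /allP v0; apply/colP=> i; rewrite mxE.
by have := v0 i (mem_index_enum _); rewrite sqrf_eq0 => /eqP.
Qed.

Lemma enorm_delta (R : realType) (n : nat) (i : 'I_n) :
  enorm (delta_mx i 0 : 'cV[R]_n) = 1.
Proof.
rewrite /enorm (bigD1 i) //= mxE !eqxx big1 => [|j /negPf ji].
  by rewrite expr1n addr0 sqrtr1.
by rewrite mxE ji expr0n.
Qed.

(** If [w = 0] the weight is zero and any unit vector will do; [i0] supplies a coordinate vector. *)
Lemma dyad_unit (R : realType) (n : nat) (w : 'cV[R]_n) (i0 : 'I_n) :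
  exists2 v : 'cV[R]_n, enorm v = 1 & w *m w^T = enorm w ^+ 2 *: (v *m v^T).
Proof.
have [w0|wN0] := eqVneq (enorm w) 0.
  exists (delta_mx i0 0); first exact: enorm_delta.
  by rewrite w0 expr0n scale0r (enorm_eq0 w0) mul0mx.
exists ((enorm w)^-1 *: w).
  by rewrite enormZ ger0_norm ?invr_ge0 ?sqrtr_ge0 // mulVf.
rewrite [(_ *: _)^T]linearZ /= -scalemxAl -scalemxAr !scalerA.
rewrite -mulrA -invfM -expr2.
by rewrite mulfV ?scale1r // sqrf_eq0.
Qed.

Lemma psdmx_unit_dyad_decomp (R : realType) (n : nat) (X : 'M[R]_n) :
  psdmx X ->
  exists (c : 'I_n -> R) (v : 'I_n -> 'cV[R]_n),
    [/\ forall j, 0 <= c j, forall j, enorm (v j) = 1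
      & X = \sum_(j < n) c j *: (v j *m (v j)^T)].
Proof.
move=> psdX; have [|w ->] := psdmx_dyad_decomp psdX (leqnn n).
  by move=> i j; rewrite leqNgt ltn_ord.
(* There are as many dyads as coordinates, so [j] itself can serve as the coordinate index, even
   when [n] may be zero. *)
have [v v1 wE] := fin_all_exists2 (fun j => dyad_unit (w j) j).
exists (fun j => enorm (w j) ^+ 2), v; split=> // [j|]; first exact: sqr_ge0.
exact: eq_bigr.
Qed.

Lemma psdmx_sum_dyad (R : realType) (n k : nat) (c : 'I_k -> R)
    (v : 'I_k -> 'cV[R]_n) :
  (forall j, 0 <= c j) -> psdmx (\sum_(j < k) c j *: (v j *m (v j)^T)).
Proof.
move=> c_ge0; split.
  apply/symmetricmxP; rewrite linear_sum; apply: eq_bigr => j _ /=.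
  by rewrite [LHS]linearZ /= trmx_mul trmxK.
move=> x; rewrite mulmx_sumr mulmx_suml summxE; apply: sumr_ge0 => j _.
rewrite -scalemxAr -scalemxAl [fun_of_matrix (_ *: _) _ _]mxE mulr_ge0 //.
have -> : x^T *m (v j *m (v j)^T) *m x = (x^T *m v j) *m (x^T *m v j)^T.
  by rewrite trmx_mul trmxK !mulmxA.
by rewrite mxE big_ord1 [fun_of_matrix _^T _ _]mxE -expr2 sqr_ge0.
Qed.

Lemma spectramap_sum (R : realType) (m n k : nat) (A : 'I_m -> 'M[R]_n)
    (c : 'I_k -> R) (Y : 'I_k -> 'M[R]_n) :
  spectramap A (\sum_(j < k) c j *: Y j) =
    \sum_(j < k) c j *: spectramap A (Y j).
Proof.
apply/colP=> i; rewrite summxE mxE /tr_inner mulmx_sumr linear_sum /=.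
by apply: eq_bigr => j _; rewrite !mxE -scalemxAr linearZ.
Qed.

Theorem theorem10 (R : realType) (m n : nat) (A : 'I_m -> 'M[R]_n)
    (hA : forall i : 'I_m, A i \is symmetricmx) (b : 'cV[R]_m)
    (hb : spectrahull A b) :
  exists X : 'M[R]_n,
    [/\ spectraplex X,
        spectramap A X = b
      & exists2 k : nat, (k <= minn m.+1 n)%N & convex_comb_unit_rank1 k X].
Proof.
case: hb => X [trX psdX] <-{b}.
have [c [v [c_ge0 v1 XE]]] := psdmx_unit_dyad_decomp psdX.
pose D j := v j *m (v j)^T.
(* The leading entry 1 is the trace of the unit dyad [D j]; keeping it fixed preserves the sum of
   the weights. *)
pose P : 'M[R]_(n, 1 + m) := \matrix_j row_mx 1%:M (spectramap A (D j))^T.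
have row_c_ge0 j : 0 <= (\row_j c j) 0 j by rewrite mxE.
have [l [f [c' [le_l c'_ge0 c'P]]]] := caratheodory_cone P row_c_ge0.
(* The selection [g] is arbitrary so as to cover both the full family ([id]) and the thinned one
   ([f]). *)
have trD k (a : 'I_k -> R) (g : 'I_k -> 'I_n) :
    \tr (\sum_j a j *: D (g j)) = \sum_j a j.
  rewrite linear_sum; apply: eq_bigr => j _ /=.
  by rewrite linearZ /= mxtrace_dyad v1 expr1n mulr1.
have PEl j : P j (lshift m 0) = 1 by rewrite mxE row_mxEl mxE eqxx.
have PEr j i : P j (rshift 1 i) = spectramap A (D j) i 0.
  by rewrite mxE row_mxEr mxE.
have c'PE i : \sum_j c' 0 j * P (f j) i = \sum_j c j * P j i.
  have /rowP/(_ i) := c'P; rewrite [LHS]mxE [RHS]mxE => c'Pi.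
  transitivity (\sum_j c' 0 j * rowsub f P j i).
    by apply: eq_bigr => j _; rewrite [rowsub _ _ _ _]mxE.
  by rewrite c'Pi; apply: eq_bigr => j _; rewrite [(\row__ _) _ _]mxE.
have lsumE : \sum_j c' 0 j = \sum_j c j.
  have := c'PE (lshift m 0); under eq_bigr do rewrite PEl mulr1.
  by move=> ->; apply: eq_bigr => j _; rewrite PEl mulr1.
have rsumE : \sum_j c' 0 j *: spectramap A (D (f j))
    = \sum_j c j *: spectramap A (D j).
  apply/colP=> i; rewrite !summxE.
  transitivity (\sum_j c' 0 j * P (f j) (rshift 1 i)).
    by apply: eq_bigr => j _; rewrite PEr mxE.
  by rewrite c'PE; apply: eq_bigr => j _; rewrite PEr [RHS]mxE.
have sumc1 : \sum_j c' 0 j = 1.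
  by rewrite lsumE -(trD n c id) -trX XE.
exists (\sum_j c' 0 j *: D (f j)); split.
- by split; [rewrite trD | apply: psdmx_sum_dyad].
- by rewrite XE !spectramap_sum.
- exists l => //; exists (fun j => c' 0 j), (v \o f); split=> // j.
  exact: v1.
Qed.
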